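(* Let $\mathbb{C}$ be a finitely complete and finitely cocomplete category. Then $(\mathsf{NEpi}(\mathbb{C}),\mathcal{K},\mathsf{NMono}(\mathbb{C}))$ with $\mathcal{K}={}^{\bot}\mathsf{NMono}(\mathbb{C})\cap\mathsf{NEpi}(\mathbb{C})^{\bot}$ is an orthogonal threefold factorization system of $\mathbb{C}$ if, and only if, normal decompositions in $\mathbb{C}$ are perfect, i.e., if, and only if, both classes $\mathsf{NMono}(\mathbb{C})$ and $\mathsf{NEpi}(\mathbb{C})$ are closed under composition.
   Context: Let $1$ and $0$ denote the terminal and initial object of $\mathbb{C}$. For a morphism $f:A\to B$, form the pushout $B+_A1$ of $f$ along $A\to 1$, and let $N_f$ be the pullback of the two pushout injections $B\to B+_A1\leftarrow 1$, with projection $\nu_f:N_f\to B$ and induced morphism $\hat f:A\to N_f$ satisfying $\nu_f\cdot\hat f=f$. Dually, form the pullback $0\times_BA$ of $0\to B$ and $f$, and let $P_f$ be the pushout of the two projections $0\leftarrow 0\times_BA\to A$, with injection $\pi_f:A\to P_f$ and induced morphism $\check f:P_f\to B$ satisfying $\check f\cdot\pi_f=f$. The morphism $f$ is a normal monomorphism ($f\in\mathsf{NMono}(\mathbb{C})$) if $\hat f$ is an isomorphism, and a normal epimorphism ($f\in\mathsf{NEpi}(\mathbb{C})$) if $\check f$ is an isomorphism. One writes $f\bot g$ if whenever $g\cdot u=v\cdot f$ there is a unique $t$ with $t\cdot f=u$ and $g\cdot t=v$; ${}^{\bot}\mathcal{M}=\{f\mid\forall m\in\mathcal{M}:f\bot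 m\}$ and $\mathcal{E}^{\bot}=\{g\mid\forall e\in\mathcal{E}:e\bot g\}$. A triple $(\mathcal{P},\mathcal{K},\mathcal{N})$ of classes of morphisms, each containing all identities and closed under composition with isomorphisms from either side, is an orthogonal threefold factorization system of $\mathbb{C}$ if every morphism of $\mathbb{C}$ is of the form $n\cdot k\cdot p$ with $p\in\mathcal{P}$, $k\in\mathcal{K}$, $n\in\mathcal{N}$, and if for all $p\in\mathcal{P}$, $k,k'\in\mathcal{K}$, $n\in\mathcal{N}$ and all $u,v$ with $n\cdot k'\cdot u=v\cdot k\cdot p$ there are uniquely determined morphisms $s,t$ with $s\cdot p=u$, $k'\cdot s=t\cdot k$ and $n\cdot t=v$ (where $s$ goes from the codomain of $p$ to the domain of $k'$, and $t$ from the codomain of $k$ to the domain of $n$). *)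

(* Defs.v *)
From Stdlib Require Import FinFun.

Set Implicit Arguments.
Unset Strict Implicit.
Unset Printing Implicit Defensive.

(* Morphisms are compared with Leibniz equality. *)
Record category := Category {
  obj :> Type;
  hom : obj -> obj -> Type;
  idm : forall A, hom A A;
  comp : forall A B D, hom B D -> hom A B -> hom A D;
  comp_idl : forall A B (f : hom A B), comp (idm B) f = f;
  comp_idr : forall A B (f : hom A B), comp f (idm A) = f;
  comp_assoc : forall A B D E (h : hom D E) (g : hom B D) (f : hom A B),
    comp h (comp g f) = comp (comp h g) f
}.

Arguments hom {c} _ _.
Arguments idm {c} A.
Arguments comp {c A B D} _ _.
Arguments comp_idl {c A B} _.
Arguments comp_idr {c A B} _.
Arguments comp_assoc {c A B D E} _ _ _.

Notation "g ∘ f" := (comp g f) (at level 40, left associativity).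

(** * Finite limits and colimits *)

Record functor (J C : category) := Functor {
  fobj :> J -> C;
  fmap : forall i j, hom i j -> hom (fobj i) (fobj j);
  fmap_id : forall i, fmap (idm i) = idm (fobj i);
  fmap_comp : forall i j k (b : hom j k) (a : hom i j),
    fmap (b ∘ a) = fmap b ∘ fmap a
}.

Arguments fmap {J C} _ {i j} _.

Definition finite_category (J : category) : Prop :=
  Finite J /\ forall i j : J, Finite (hom i j).

Definition is_cone (J C : category) (D : functor J C) (L : C)
    (p : forall i : J, hom L (D i)) : Prop :=
  forall (i j : J) (a : hom i j), fmap D a ∘ p i = p j.

Definition is_limit (J C : category) (D : functor J C) (L : C)
    (p : forall i : J, hom L (D i)) : Prop :=
  is_cone p /\
  forall (X : C) (x : forall i : J, hom X (D i)), is_cone x ->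
    exists! t : hom X L, forall i, p i ∘ t = x i.

Definition is_cocone (J C : category) (D : functor J C) (L : C)
    (p : forall i : J, hom (D i) L) : Prop :=
  forall (i j : J) (a : hom i j), p j ∘ fmap D a = p i.

Definition is_colimit (J C : category) (D : functor J C) (L : C)
    (p : forall i : J, hom (D i) L) : Prop :=
  is_cocone p /\
  forall (X : C) (x : forall i : J, hom (D i) X), is_cocone x ->
    exists! t : hom L X, forall i, t ∘ p i = x i.

Definition finitely_complete (C : category) : Prop :=
  forall (J : category) (D : functor J C), finite_category J ->
    exists (L : C) (p : forall i : J, hom L (D i)), is_limit p.

Definition finitely_cocomplete (C : category) : Prop :=
  forall (J : category) (D : functor J C), finite_category J ->
    exists (L : C) (p : forall i : J, hom (D i) L), is_colimit p.

Definition is_terminal (C : category) (T : C) : Prop :=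
  forall X : C, exists! t : hom X T, True.

Definition is_initial (C : category) (I : C) : Prop :=
  forall X : C, exists! t : hom I X, True.

(* [p] is opposite to [g], and [q] to [f]. *)
Definition is_pullback (C : category) (A B D P : C)
    (f : hom A D) (g : hom B D) (p : hom P A) (q : hom P B) : Prop :=
  f ∘ p = g ∘ q /\
  forall (X : C) (x : hom X A) (y : hom X B), f ∘ x = g ∘ y ->
    exists! t : hom X P, p ∘ t = x /\ q ∘ t = y.

Definition is_pushout (C : category) (A B D P : C)
    (f : hom D A) (g : hom D B) (i : hom A P) (j : hom B P) : Prop :=
  i ∘ f = j ∘ g /\
  forall (X : C) (x : hom A X) (y : hom B X), x ∘ f = y ∘ g ->
    exists! t : hom P X, t ∘ i = x /\ t ∘ j = y.

Definition is_iso (C : category) (A B : C) (f : hom A B) : Prop :=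
  exists g : hom B A, g ∘ f = idm A /\ f ∘ g = idm B.

(** * Normal monomorphisms and normal epimorphisms *)

(* [md_po] is B +_A 1 and [md_N] is N_f, with projection [md_nu] and induced
   morphism [md_hat]. All of these are determined by f only up to unique
   compatible isomorphism; the record is one choice of them. *)
Record mono_decomposition (C : category) (A B : C) (f : hom A B) := {
  md_one : C;
  md_one_terminal : is_terminal md_one;
  md_bang : hom A md_one;
  md_po : C;
  md_inB : hom B md_po;
  md_in1 : hom md_one md_po;
  md_pushout : is_pushout f md_bang md_inB md_in1;
  md_N : C;
  md_nu : hom md_N B;
  md_pr1 : hom md_N md_one;
  md_pullback : is_pullback md_inB md_in1 md_nu md_pr1;
  md_hat : hom A md_N;
  md_nu_hat : md_nu ∘ md_hat = f;
  md_pr1_hat : md_pr1 ∘ md_hat = md_bang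
}.

(* [ed_pb] is 0 x_B A and [ed_P] is P_f, with injection [ed_pi] and induced
   morphism [ed_check]. *)
Record epi_decomposition (C : category) (A B : C) (f : hom A B) := {
  ed_zero : C;
  ed_zero_initial : is_initial ed_zero;
  ed_bang : hom ed_zero B;
  ed_pb : C;
  ed_prA : hom ed_pb A;
  ed_pr0 : hom ed_pb ed_zero;
  ed_pullback : is_pullback f ed_bang ed_prA ed_pr0;
  ed_P : C;
  ed_pi : hom A ed_P;
  ed_in0 : hom ed_zero ed_P;
  ed_pushout : is_pushout ed_prA ed_pr0 ed_pi ed_in0;
  ed_check : hom ed_P B;
  ed_check_pi : ed_check ∘ ed_pi = f;
  ed_check_in0 : ed_check ∘ ed_in0 = ed_bang
}.

Definition mor_class (C : category) : Type := forall A B : C, hom A B -> Prop.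

(* Whether [md_hat] is invertible does not depend on the choice of [d], and
   some [d] exists in a finitely complete and cocomplete category. *)
Definition NMono (C : category) : mor_class C := fun A B f =>
  exists d : mono_decomposition f, is_iso (md_hat d).

Definition NEpi (C : category) : mor_class C := fun A B f =>
  exists d : epi_decomposition f, is_iso (ed_check d).

Arguments NMono C [A B] f.
Arguments NEpi C [A B] f.

(** * Orthogonality and factorization systems *)

Definition orthogonal (C : category) (A B X Y : C)
    (f : hom A B) (g : hom X Y) : Prop :=
  forall (u : hom A X) (v : hom B Y), g ∘ u = v ∘ f ->
    exists! t : hom B X, t ∘ f = u /\ g ∘ t = v.

Definition left_orth (C : category) (M : mor_class C) : mor_class C :=
  fun A B f => forall (X Y : C) (m : hom X Y), M X Y m -> orthogonal f m.

Definition right_orth (C : category) (E : mor_class C) : mor_class C :=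
  fun X Y g => forall (A B : C) (e : hom A B), E A B e -> orthogonal e g.

Definition class_inter (C : category) (M N : mor_class C) : mor_class C :=
  fun A B f => M A B f /\ N A B f.

Definition contains_identities (C : category) (M : mor_class C) : Prop :=
  forall A : C, M A A (idm A).

Definition closed_under_isos (C : category) (M : mor_class C) : Prop :=
  (forall (A B D : C) (f : hom A B) (i : hom B D),
     M A B f -> is_iso i -> M A D (i ∘ f)) /\
  (forall (A B D : C) (i : hom A B) (f : hom B D),
     is_iso i -> M B D f -> M A D (f ∘ i)).

Definition closed_under_composition (C : category) (M : mor_class C) : Prop :=
  forall (A B D : C) (g : hom B D) (f : hom A B),
    M B D g -> M A B f -> M A D (g ∘ f).

Definition threefold_factorizations (C : category) (P K N : mor_class C)
    : Prop :=
  forall (A B : C) (f : hom A B),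
    exists (X Y : C) (p : hom A X) (k : hom X Y) (n : hom Y B),
      P A X p /\ K X Y k /\ N Y B n /\ f = n ∘ k ∘ p.

(* The pair (s, t) is unique, rather than t being unique for a unique s. *)
Definition threefold_diagonalization (C : category) (P K N : mor_class C)
    : Prop :=
  forall (A X Y B : C) (p : hom A X) (k : hom X Y) (v : hom Y B)
         (X' Y' : C) (u : hom A X') (k' : hom X' Y') (n : hom Y' B),
    P A X p -> K X Y k -> K X' Y' k' -> N Y' B n ->
    n ∘ k' ∘ u = v ∘ k ∘ p ->
    exists! st : hom X X' * hom Y Y',
      fst st ∘ p = u /\ k' ∘ fst st = snd st ∘ k /\ n ∘ snd st = v.

Definition orthogonal_threefold_fs (C : category) (P K N : mor_class C)
    : Prop :=
  (contains_identities P /\ contains_identities K /\ contains_identities N) /\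
  (closed_under_isos P /\ closed_under_isos K /\ closed_under_isos N) /\
  threefold_factorizations P K N /\
  threefold_diagonalization P K N.

(* Main.v *)
From Stdlib Require Import ssreflect ssrfun List.
Require Import Defs.

Set Implicit Arguments.
Unset Strict Implicit.
Unset Printing Implicit Defensive.

(** Normal monomorphisms are exactly the pullbacks of points [1 -> Q]. Hence
    they are monic and stable under pullback, and [nu_f] is the least normal
    monomorphism through which [f] factors. If they are closed under
    composition, pulling a normal monomorphism [m] back along [v] in a square
    [m u = v hat_f] and composing with [nu_f] gives a normal monomorphism
    through which [f] factors; by minimality the pullback of [m] is invertible,
    so that [hat_f] is orthogonal to [m]. Dually for normal epimorphisms.
    Moreover every morphism into [0] is orthogonal to every monomorphism, hence
    so is every normal epimorphism, being a pushout of such a morphism; this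
    lets the two factorizations be combined. Conversely, in a threefold system
    the right class is the right orthogonal complement of the composites
    [k p], and right orthogonal complements are closed under composition. *)

(** * Opposite categories, cancellable morphisms, existence of basic (co)limits *)

(** Because of [eq_sym], [op (op C)] is not convertible to [C], so transfers to and from [op C] are
    stated separately. *)
Definition op (C : category) : category :=
  @Category C (fun A B => hom B A) (fun A => idm A)
    (fun A B D g f => f ∘ g)
    (fun A B f => comp_idr f) (fun A B f => comp_idl f)
    (fun A B D E h g f => eq_sym (comp_assoc f g h)).

Definition op_class (C : category) (M : mor_class C) : mor_class (op C) :=
  fun A B f => M B A f.

Definition monic (C : category) (A B : C) (f : hom A B) : Prop :=
  forall (X : C) (x y : hom X A), f ∘ x = f ∘ y -> x = y.

Definition epic (C : category) (A B : C) (f : hom A B) : Prop :=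
  forall (X : C) (x y : hom B X), x ∘ f = y ∘ f -> x = y.

Definition has_pullbacks (C : category) : Prop :=
  forall (A B D : C) (f : hom A D) (g : hom B D),
    exists (P : C) (p : hom P A) (q : hom P B), is_pullback f g p q.

Definition has_pushouts (C : category) : Prop :=
  forall (A B D : C) (f : hom D A) (g : hom D B),
    exists (P : C) (i : hom A P) (j : hom B P), is_pushout f g i j.

Definition has_terminal (C : category) : Prop := exists T : C, is_terminal T.

Definition has_initial (C : category) : Prop := exists I : C, is_initial I.

(** * Pullbacks and terminal objects from finite limits *)

Inductive cospan_obj := cospan_left | cospan_right | cospan_apex.

Definition cospan_hom (i j : cospan_obj) : Set :=
  match i, j with
  | cospan_left, cospan_left | cospan_right, cospan_right
  | _, cospan_apex => unit
  | _, _ => Empty_set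
  end.

Definition cospan : category.
Proof.
unshelve refine (@Category cospan_obj cospan_hom _ _ _ _ _).
- by case.
- by case; case; case.
- by case; case; case.
- by case; case; case.
- by case; case; case; case; case; case; case.
Defined.

Lemma cospan_finite : finite_category cospan.
Proof.
split; first by exists (cospan_left :: cospan_right :: cospan_apex :: nil);
  case; rewrite /=; tauto.
by case; case; try (by exists nil; case); exists (tt :: nil); case; left.
Qed.

Definition cospan_diagram (C : category) (A B D : C)
  (f : hom A D) (g : hom B D) : functor cospan C.
Proof.
unshelve refine (@Functor cospan C
  (fun i => match i with
            | cospan_left => A | cospan_right => B | cospan_apex => D end)
  _ _ _).
- case; case; case.
  + exact (idm A).
  + exact f.
  + exact (idm B).
  + exact g.
  + exact (idm D).
- by case.
- by case; case; case; case; case; rewrite /= ?comp_idl ?comp_idr.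
Defined.

Lemma finitely_complete_pullbacks (C : category) :
  finitely_complete C -> has_pullbacks C.
Proof.
move=> hC A B D f g.
have [L [p [cone_p univ_p]]] := hC _ (cospan_diagram f g) cospan_finite.
have pf : f ∘ p cospan_left = p cospan_apex
  := cone_p cospan_left cospan_apex tt.
have pg : g ∘ p cospan_right = p cospan_apex
  := cone_p cospan_right cospan_apex tt.
exists L, (p cospan_left), (p cospan_right); split; first by rewrite pf pg.
move=> X x y fxgy.
(* A cone over a cospan is determined by its two outer legs; the apex leg is forced. *)
pose c (i : cospan) : hom X (cospan_diagram f g i) :=
  match i with
  | cospan_left => x | cospan_right => y | cospan_apex => f ∘ x end.
have cone_c : is_cone c.
  by case; case; case; rewrite /= ?comp_idl.
have [t [tc t_uniq]] := univ_p X c cone_c.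
exists t; split; first by split; [exact: (tc cospan_left) | exact: (tc cospan_right)].
move=> t' [t'x t'y]; apply: t_uniq; case => //=.
by rewrite -pf -comp_assoc t'x.
Qed.

Definition empty_category : category.
Proof. by unshelve refine (@Category Empty_set (fun _ _ => unit) _ _ _ _ _); case. Defined.

Definition empty_diagram (C : category) : functor empty_category C.
Proof. by unshelve refine (@Functor empty_category C _ _ _ _); case. Defined.

Lemma finitely_complete_terminal (C : category) :
  finitely_complete C -> has_terminal C.
Proof.
move=> hC.
have fin : finite_category empty_category by split; [exists nil|]; case.
have [L [p [_ univ_p]]] := hC _ (empty_diagram C) fin.
exists L => X.
have [|t [_ t_uniq]] := univ_p X (fun i : empty_category => match i with end).
  by case.
by exists t; split=> // t' _; apply: t_uniq; case.
Qed.

Definition op_functor (J C : category) (D : functor J (op C)) :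
  functor (op J) C :=
  @Functor (op J) C (fun i => D i) (fun i j a => fmap D a)
    (fun i => fmap_id D i) (fun i j k b a => fmap_comp D a b).

Lemma finitely_cocomplete_op (C : category) :
  finitely_cocomplete C -> finitely_complete (op C).
Proof.
move=> hC J D [finJ fin_hom].
have fin : finite_category (op J) by split=> // i j; apply: fin_hom.
have [L [p [cocone_p univ_p]]] := hC _ (op_functor D) fin.
exists L, p; split; first by move=> i j a; exact: (cocone_p j i a).
by move=> X x cone_x; apply: univ_p => i j a; exact: cone_x.
Qed.

(** * Normal monomorphisms as pullbacks of points *)

Lemma id_iso (C : category) (A : C) : is_iso (idm A).
Proof. by exists (idm A); rewrite comp_idl. Qed.

Lemma pullback_iso (C : category) (A B D P P' : C) (f : hom A D) (g : hom B D)
    (p : hom P A) (q : hom P B) (i : hom P' P) :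
  is_pullback f g p q -> is_iso i -> is_pullback f g (p ∘ i) (q ∘ i).
Proof.
move=> [fpgq univ] [j [ji ij]]; split; first by rewrite !comp_assoc fpgq.
move=> X x y fxgy.
have [t [[pt qt] t_uniq]] := univ X x y fxgy.
exists (j ∘ t); split.
  by rewrite -!comp_assoc (comp_assoc i j t) ij comp_idl.
move=> t' [pt' qt']; rewrite (t_uniq (i ∘ t')) ?comp_assoc //.
by rewrite ji comp_idl.
Qed.

Lemma pullback_paste (C : category) (Y T Q X W P : C)
    (q : hom Y Q) (pt : hom T Q) (m : hom X Y) (b : hom X T)
    (v : hom W Y) (p : hom P W) (r : hom P X) :
  is_pullback q pt m b -> is_pullback v m p r ->
  is_pullback (q ∘ v) pt p (b ∘ r).
Proof.
move=> [qm univ_m] [vp univ_p]; split.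
  by rewrite -comp_assoc vp !comp_assoc qm.
move=> Z x y; rewrite -comp_assoc => qvx.
have [h [[mh bh] h_uniq]] := univ_m Z (v ∘ x) y qvx.
have [t [[ptx rt] t_uniq]] := univ_p Z x h (eq_sym mh).
exists t; split; first by rewrite -comp_assoc rt.
move=> t' [pt' brt']; apply: t_uniq; split=> //; symmetry; apply: h_uniq.
by split; rewrite comp_assoc // -vp -comp_assoc pt'.
Qed.

Lemma NMono_pullback (C : category) (A B : C) (f : hom A B) :
  NMono C f ->
  exists (T Q : C) (q : hom B Q) (pt : hom T Q) (b : hom A T),
    is_terminal T /\ is_pullback q pt f b.
Proof.
move=> [d iso_d].
exists (md_one d), (md_po d), (md_inB d), (md_in1 d), (md_bang d).
split; first exact: md_one_terminal.
have := pullback_iso (md_pullback d) iso_d.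
by rewrite md_nu_hat md_pr1_hat.
Qed.

(** The pushout of [f] along [b] maps to [Q], so a pair of morphisms that agrees in the pushout also
    agrees in [Q]. Hence the pushout square is itself a pullback, and [f] can serve as its own
    [md_nu], with [md_hat] the identity. *)
Lemma pullback_NMono (C : category) (po : has_pushouts C) (A B T Q : C)
    (f : hom A B) (q : hom B Q) (pt : hom T Q) (b : hom A T) :
  is_terminal T -> is_pullback q pt f b -> NMono C f.
Proof.
move=> termT [qf univ_f].
have [R [i [j ij_po]]] := po _ _ _ f b.
have [c [[ci cj] _]] := ij_po.2 Q q pt qf.
have ij_pb : is_pullback i j f b.
  split; first exact: ij_po.1.
  move=> X x y ixjy; apply: univ_f.
  by rewrite -ci -cj -!comp_assoc ixjy.
by exists (Build_mono_decomposition termT ij_po ij_pb (comp_idr f) (comp_idr b));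
  exact: id_iso.
Qed.

(** A morphism out of a terminal object is monic, and pullbacks preserve this. *)
Lemma NMono_monic (C : category) (A B : C) (f : hom A B) :
  NMono C f -> monic f.
Proof.
move=> /NMono_pullback [T [Q [q [pt [b [termT [qf univ_f]]]]]]] X x y fxfy.
have [t0 [_ T_uniq]] := termT X.
have [|t [_ t_uniq]] := univ_f X (f ∘ x) (b ∘ x).
  by rewrite !comp_assoc qf.
rewrite -(t_uniq x) // -(t_uniq y) //; split=> //.
by rewrite -(T_uniq (b ∘ x)) // -(T_uniq (b ∘ y)).
Qed.

Lemma NMono_stable (C : category) (po : has_pushouts C) (X Y W P : C)
    (m : hom X Y) (v : hom W Y) (p : hom P W) (r : hom P X) :
  NMono C m -> is_pullback v m p r -> NMono C p.
Proof.
move=> /NMono_pullback [T [Q [q [pt [b [termT pb_m]]]]]] pb_p.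
exact: (pullback_NMono po termT (pullback_paste pb_m pb_p)).
Qed.

Lemma NMono_id (C : category) (po : has_pushouts C) (te : has_terminal C) :
  contains_identities (NMono C).
Proof.
move=> A; have [T termT] := te; have [b _] := termT A.
(* The identity of [A] is the pullback of the identity of [T] along [b]. *)
apply: (pullback_NMono po (q := b) (pt := idm T) (b := b)) termT _.
split; first by rewrite comp_idl comp_idr.
move=> X x y; rewrite comp_idl => bx.
exists x; split; first by rewrite comp_idl.
by move=> t [<- _]; rewrite comp_idl.
Qed.

Lemma NMono_isos (C : category) (po : has_pushouts C) :
  closed_under_isos (NMono C).
Proof.
split=> A B D.
  move=> f i nf [j [ji ij]].
  (* [i ∘ f] is the pullback of [f] along the inverse [j] of [i]. *)
  apply: (NMono_stable po (v := j) (r := idm A)) nf _; split.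
    by rewrite comp_assoc ji comp_idl comp_idr.
  move=> X x y jxfy; exists y; split.
    by rewrite -comp_assoc -jxfy comp_assoc ij !comp_idl.
  by move=> t [_ <-]; rewrite comp_idl.
move=> i f iso_i /NMono_pullback [T [Q [q [pt [b [termT pb_f]]]]]].
exact: (pullback_NMono po termT (pullback_iso pb_f iso_i)).
Qed.

(** The witness [n] is [nu_f]. If [m] is the pullback of a point [pt] along [q] and [f] factors
    through [m], then [q ∘ f] is constant at [pt], so [q] factors through the pushout defining [n].
    Thus [q ∘ n] is constant at [pt] too, and [n] factors through [m]. *)
Lemma NMono_least (C : category) (pb : has_pullbacks C) (po : has_pushouts C)
    (te : has_terminal C) (A B : C) (f : hom A B) :
  exists (N : C) (n : hom N B) (e : hom A N),
    NMono C n /\ f = n ∘ e /\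
    forall (X : C) (m : hom X B) (g : hom A X), NMono C m -> f = m ∘ g ->
      exists s : hom N X, n = m ∘ s.
Proof.
have [T termT] := te; have [b _] := termT A.
have [R [i [j [ifjb univ_ij]]]] := po _ _ _ f b.
have [N [n [z [injz univ_n]]]] := pb _ _ _ i j.
have [e [[ne _] _]] := univ_n A f b ifjb.
exists N, n, e; split.
  exact: (pullback_NMono po termT (conj injz univ_n)).
split=> // X m g /NMono_pullback [T' [Q [q [pt [c [termT' [qm univ_m]]]]]]] fmg.
(* The terminal objects chosen for [n] and for [m] may differ. *)
have [w _] := termT' T.
have [w' [_ T'_uniq]] := termT' A.
have [|h [[hi hj] _]] := univ_ij Q q (pt ∘ w).
  rewrite fmg comp_assoc qm -!comp_assoc.
  by rewrite -(T'_uniq (c ∘ g)) // -(T'_uniq (w ∘ b)).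
have [|s [[ms _] _]] := univ_m N n (w ∘ z); last by exists s.
by rewrite -hi comp_assoc -hj -!comp_assoc injz.
Qed.

(** * Orthogonality *)

(** Cancelling [g] yields both the upper triangle and uniqueness. *)
Lemma monic_orthogonal (C : category) (A B X Y : C)
    (f : hom A B) (g : hom X Y) :
  monic g ->
  (forall u v, g ∘ u = v ∘ f -> exists t, g ∘ t = v) ->
  orthogonal f g.
Proof.
move=> mg lift u v guvf; have [t gt] := lift u v guvf.
exists t; split; first by split=> //; apply: mg; rewrite comp_assoc gt.
by move=> t' [_ gt']; apply: mg; rewrite gt gt'.
Qed.

Lemma orthogonal_op (C : category) (A B X Y : C)
    (f : hom A B) (g : hom X Y) :
  orthogonal f g -> @orthogonal (op C) Y X B A g f.
Proof.
move=> fg u v /= ufgv; have [t [[tf gt] t_uniq]] := fg v u (eq_sym ufgv).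
by exists t; split=> // t' [gt' t'f]; apply: t_uniq.
Qed.

Lemma iso_orthogonal (C : category) (A B X Y : C)
    (i : hom A B) (g : hom X Y) : is_iso i -> orthogonal i g.
Proof.
move=> [j [ji ij]] u v guvi; exists (u ∘ j); split.
  split; first by rewrite -comp_assoc ji comp_idr.
  by rewrite comp_assoc guvi -comp_assoc ij comp_idr.
by move=> t [<- _]; rewrite -comp_assoc ij comp_idr.
Qed.

Lemma orthogonal_comp_l (C : category) (A B D X Y : C)
    (f : hom A B) (f' : hom B D) (g : hom X Y) :
  orthogonal f g -> orthogonal f' g -> orthogonal (f' ∘ f) g.
Proof.
move=> fg f'g u v; rewrite comp_assoc => guv.
have [s [[sf gs] s_uniq]] := fg _ _ guv.
have [t [[tf gt] t_uniq]] := f'g _ _ gs.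
exists t; split; first by rewrite comp_assoc tf.
move=> t' [t'u t'v]; apply: t_uniq; split=> //; symmetry; apply: s_uniq.
by rewrite -comp_assoc t'u comp_assoc t'v.
Qed.

Lemma is_iso_op (C : category) (A B : C) (f : hom A B) :
  is_iso f -> @is_iso (op C) B A f.
Proof. by move=> [g [gf fg]]; exists g. Qed.

Lemma is_iso_of_op (C : category) (A B : C) (f : hom A B) :
  @is_iso (op C) B A f -> is_iso f.
Proof. by move=> [g [gf fg]]; exists g. Qed.

Lemma orthogonal_of_op (C : category) (A B X Y : C)
    (f : hom A B) (g : hom X Y) :
  @orthogonal (op C) Y X B A g f -> orthogonal f g.
Proof.
move=> fg u v guvf; have [t [[tf gt] t_uniq]] := fg v u (eq_sym guvf).
by exists t; split=> // t' [gt' t'f]; apply: t_uniq.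
Qed.

Lemma orthogonal_comp_r (C : category) (A B X Y Z : C)
    (f : hom A B) (g : hom X Y) (g' : hom Y Z) :
  orthogonal f g -> orthogonal f g' -> orthogonal f (g' ∘ g).
Proof.
move=> fg fg'; apply: orthogonal_of_op.
exact: (@orthogonal_comp_l (op C)) (orthogonal_op fg') (orthogonal_op fg).
Qed.

Lemma orthogonal_iso (C : category) (A B X Y : C)
    (f : hom A B) (i : hom X Y) : is_iso i -> orthogonal f i.
Proof.
by move=> iso_i; apply: orthogonal_of_op;
  exact: (@iso_orthogonal (op C)) (is_iso_op iso_i).
Qed.

Lemma left_orth_isos (C : category) (M : mor_class C) :
  closed_under_isos (left_orth M).
Proof.
by split=> A B D => [f i Mf iso_i | i f iso_i Mf] X Y m Mm;
  apply: orthogonal_comp_l; solve [exact: iso_orthogonal | exact: Mf].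
Qed.

Lemma right_orth_isos (C : category) (E : mor_class C) :
  closed_under_isos (right_orth E).
Proof.
by split=> A B D => [f i Ef iso_i | i f iso_i Ef] X Y e Ee;
  apply: orthogonal_comp_r; solve [exact: orthogonal_iso | exact: Ef].
Qed.

(** Write [g ∘ f = m ∘ e]. As [e] is orthogonal to [g ∘ f], it acquires a left inverse [t]; this is
    two-sided, so [g ∘ f] is [m] up to isomorphism. *)
Lemma factorization_comp (C : category) (E M : mor_class C) :
  closed_under_isos M ->
  (forall (A B X Y : C) (e : hom A B) (m : hom X Y),
     E A B e -> M X Y m -> orthogonal e m) ->
  (forall (A B : C) (f : hom A B), exists (X : C) (e : hom A X) (m : hom X B),
     E A X e /\ M X B m /\ f = m ∘ e) ->
  closed_under_composition M.
Proof.
move=> [_ isoM] EM fact A B D g f Mg Mf.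
have [X [e [m [Ee [Mm gf]]]]] := fact _ _ (g ∘ f).
have egf : orthogonal e (g ∘ f) by apply: orthogonal_comp_r; apply: EM.
have [|t [[te gft] _]] := egf (idm A) m; first by rewrite comp_idr.
rewrite gf; apply: isoM => //; exists t; split=> //.
(* Both [idm X] and [e ∘ t] are diagonals of the square with sides [e] and [m]. *)
have [|s [_ s_uniq]] := EM _ _ _ _ e m Ee Mm e m; first by [].
rewrite -(s_uniq (idm X)) ?comp_idl ?comp_idr // -(s_uniq (e ∘ t)) //.
by rewrite -comp_assoc te comp_idr comp_assoc -gf.
Qed.

Lemma NMono_left_orth_factorization (C : category) (pb : has_pullbacks C)
    (po : has_pushouts C) (te : has_terminal C)
    (compN : closed_under_composition (NMono C)) (A B : C) (f : hom A B) :
  exists (X : C) (e : hom A X) (n : hom X B),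
    left_orth (NMono C) e /\ NMono C n /\ f = n ∘ e.
Proof.
have [N [n [e [Nn [fne least]]]]] := NMono_least pb po te f.
exists N, e, n; split=> // X Y m Nm.
apply: monic_orthogonal => [|u v muve]; first exact: NMono_monic.
have [P [m' [r pb_m']]] := pb _ _ _ v m.
have Nm' := NMono_stable po Nm pb_m'.
have [w [[m'w _] _]] := pb_m'.2 A e u (eq_sym muve).
have [|s ns] := least _ (n ∘ m') w (compN _ _ _ _ _ Nn Nm').
  by rewrite -comp_assoc m'w.
(* Minimality of [n] yields a section of [m']; followed by [r] it lifts [v] through [m]. *)
have m's : m' ∘ s = idm N.
  by apply: (NMono_monic Nn); rewrite comp_idr comp_assoc.
by exists (r ∘ s); rewrite comp_assoc -pb_m'.1 -comp_assoc m's comp_idr.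
Qed.

(** * Duality *)

(** Read in [op C], the fields of an epi decomposition are those of a mono decomposition, with
    pullback and pushout exchanged. *)
Lemma NEpi_op (C : category) (A B : C) (f : hom A B) :
  NEpi C f -> @NMono (op C) B A f.
Proof.
move=> [d iso_d].
exists (@Build_mono_decomposition (op C) B A f _ (ed_zero_initial d) (ed_bang d)
  _ (ed_prA d) (ed_pr0 d) (ed_pullback d) _ (ed_pi d) (ed_in0 d) (ed_pushout d)
  (ed_check d) (ed_check_pi d) (ed_check_in0 d)).
exact: is_iso_op.
Qed.

Lemma NMono_op_NEpi (C : category) (A B : C) (f : hom A B) :
  @NMono (op C) B A f -> NEpi C f.
Proof.
move=> [d iso_d].
exists (@Build_epi_decomposition C A B f _ (md_one_terminal d) (md_bang d)
  _ (md_inB d) (md_in1 d) (md_pushout d) _ (md_nu d) (md_pr1 d) (md_pullback d)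
  (md_hat d) (md_nu_hat d) (md_pr1_hat d)).
exact: is_iso_of_op.
Qed.

Lemma NEpi_epic (C : category) (A B : C) (f : hom A B) : NEpi C f -> epic f.
Proof. by move=> /NEpi_op /NMono_monic. Qed.

Lemma NEpi_id (C : category) (pb : has_pullbacks C) (ini : has_initial C) :
  contains_identities (NEpi C).
Proof. by move=> A; apply: NMono_op_NEpi; exact: (@NMono_id (op C)). Qed.

Lemma NEpi_isos (C : category) (pb : has_pullbacks C) :
  closed_under_isos (NEpi C).
Proof.
have [isol isor] := @NMono_isos (op C) pb.
split=> A B D.
  move=> f i Ef iso_i; apply: NMono_op_NEpi.
  exact: isor (is_iso_op iso_i) (NEpi_op Ef).
move=> i f iso_i Ef; apply: NMono_op_NEpi.
exact: isol (NEpi_op Ef) (is_iso_op iso_i).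
Qed.

Lemma NEpi_right_orth_factorization (C : category) (pb : has_pullbacks C)
    (po : has_pushouts C) (ini : has_initial C)
    (compE : closed_under_composition (NEpi C)) (A B : C) (f : hom A B) :
  exists (X : C) (e : hom A X) (g : hom X B),
    NEpi C e /\ right_orth (NEpi C) g /\ f = g ∘ e.
Proof.
have compN : closed_under_composition (NMono (op C)).
  move=> X Y Z g h Ng Nh; apply: NEpi_op.
  by apply: compE; apply: NMono_op_NEpi.
have [X [g [e [orth_g [Ne fge]]]]] :=
  @NMono_left_orth_factorization (op C) po pb ini compN B A f.
exists X, e, g; split; first exact: NMono_op_NEpi.
split=> // Y Z p Ep; apply: orthogonal_of_op; apply: orth_g.
exact: NEpi_op.
Qed.

Lemma NEpi_monic_orthogonal (C : category) (A B X Y : C)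
    (p : hom A B) (m : hom X Y) : NEpi C p -> monic m -> orthogonal p m.
Proof.
(* In [C], [p] is the pushout along [a] of the morphism [z] from [Z] to the initial object [I]. *)
move=> Ep; have [I [Z [a [z [c [initI [/= pacz univ_p]]]]]]] :=
  NMono_pullback (NEpi_op Ep).
move=> mm.
apply: monic_orthogonal => // u v muvp.
have [o _] := initI X; have [o' [_ Y_uniq]] := initI Y.
have [|t [[tp _] _]] := univ_p X u o.
  (* After composing with [m], both sides are [z] followed by a morphism from [I] to [Y], and there
     is only one such. *)
  apply: mm; rewrite /= !comp_assoc muvp -comp_assoc pacz comp_assoc.
  by rewrite -(Y_uniq (v ∘ c)) // -(Y_uniq (m ∘ o)).
by exists t; apply: (NEpi_epic Ep); rewrite -comp_assoc tp.
Qed.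

(** * Threefold factorization systems *)

Lemma threefold_right_comp (C : category) (P K N : mor_class C) :
  orthogonal_threefold_fs P K N -> closed_under_composition N.
Proof.
move=> [[idP [idK idN]] [[isoP [isoK isoN]] [fact diag]]].
apply: (factorization_comp (E := fun A B f => exists X (p : hom A X) k,
  P _ _ p /\ K _ _ k /\ f = k ∘ p)) => //
  [A B X Y e m [Z [p [k [Pp [Kk ->]]]]] Nm u v muv | A B f].
  (* With an identity as second middle morphism, [s] is forced to be [t ∘ k], so unique pairs amount
     to unique diagonals of [k ∘ p] against [m]. *)
  have [|[s t] [/= [sp [st mt]] st_uniq]] :=
    diag _ _ _ _ p k v _ _ u (idm X) m Pp Kk (idK X) Nm.
    by rewrite comp_idr muv comp_assoc.
  exists t; split; first by rewrite comp_assoc -st comp_idl.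
  move=> t' [t'u t'v].
  have [] // : (s, t) = (t' ∘ k, t').
  by apply: st_uniq; rewrite /= comp_idl -comp_assoc.
have [X [Y [p [k [n [Pp [Kk [Nn fE]]]]]]]] := fact A B f.
exists Y, (k ∘ p), n; split; last by rewrite comp_assoc.
by exists X, p, k.
Qed.

(** Dual argument: in [op C] the composites [n ∘ k] form the left class and [P] the right one; now
    the first middle morphism is an identity. *)
Lemma threefold_left_comp (C : category) (P K N : mor_class C) :
  orthogonal_threefold_fs P K N -> closed_under_composition P.
Proof.
move=> [[idP [idK idN]] [[isoP [isoK isoN]] [fact diag]]].
suff compP : @closed_under_composition (op C) (op_class P).
  by move=> A B D g f Pg Pf; exact: (compP _ _ _ _ _ Pf Pg).
apply: (@factorization_comp (op C) (fun (B A : C) (f : @hom C A B) =>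
  exists (X : C) (k : @hom C A X) (n : @hom C X B),
    K _ _ k /\ N _ _ n /\ f = n ∘ k) (op_class P)) =>
  [|X Y A B f p [Z [k [n [Kk [Nn ->]]]]] Pp | B A f].
- by case: isoP => isol isor; split=> X Y Z => [f i Pf iso_i | i f iso_i Pf];
    [apply: isor | apply: isol] => //; exact: is_iso_of_op.
- apply: orthogonal_op => u v nku.
  have [|[s t] [/= [sp [st nt]] st_uniq]] :=
    diag _ _ _ _ p (idm A) v _ _ u k n Pp (idK A) Kk Nn.
    by rewrite comp_idr nku.
  exists s; split; first by rewrite -comp_assoc st comp_idr.
  move=> s' [s'u s'v].
  have [] // : (s, t) = (s', k ∘ s').
  by apply: st_uniq; rewrite /= comp_idr comp_assoc.
- have [X [Y [p [k [n [Pp [Kk [Nn fE]]]]]]]] := fact A B f.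
  by exists X, (n ∘ k), p; split; first by exists Y, k, n.
Qed.

Theorem corollary5p3 (C : category)
    (hlim : finitely_complete C) (hcolim : finitely_cocomplete C) :
  orthogonal_threefold_fs (NEpi C)
    (class_inter (left_orth (NMono C)) (right_orth (NEpi C)))
    (NMono C)
  <->
  closed_under_composition (NMono C) /\ closed_under_composition (NEpi C).
Proof.
have pb := finitely_complete_pullbacks hlim.
have te := finitely_complete_terminal hlim.
have po : has_pushouts C :=
  finitely_complete_pullbacks (finitely_cocomplete_op hcolim).
have ini : has_initial C :=
  finitely_complete_terminal (finitely_cocomplete_op hcolim).
split.
  by move=> sys; split;
    [exact: threefold_right_comp sys | exact: threefold_left_comp sys].
move=> [compN compE]; split; [|split; [|split]].
- split; first exact: NEpi_id.
  split; last exact: NMono_id.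
  by move=> A; split=> X Y g _; [apply: iso_orthogonal | apply: orthogonal_iso];
    exact: id_iso.
- split; first exact: NEpi_isos.
  split; last exact: NMono_isos.
  have [l1 l2] := @left_orth_isos C (NMono C).
  have [r1 r2] := @right_orth_isos C (NEpi C).
  by split=> A B D => [f i [Lf Rf] iso_i | i f iso_i [Lf Rf]]; split; auto.
- move=> A B f.
  have [Y [e [n [orth_e [Nn fne]]]]] :=
    NMono_left_orth_factorization pb po te compN f.
  have [X [p [k [Ep [orth_k ekp]]]]] :=
    NEpi_right_orth_factorization pb po ini compE e.
  exists X, Y, p, k, n; split=> //; split; last first.
    by split=> //; rewrite fne ekp comp_assoc.
  split=> // W Z m Nm.
  (* Precomposing the square with [p] makes it one on [e = k ∘ p], whose diagonal serves for [k] as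
     well. *)
  apply: monic_orthogonal => [|u v muvk]; first exact: NMono_monic.
  have [|t [[_ mt] _]] := orth_e _ _ m Nm (u ∘ p) v; last by exists t.
  by rewrite ekp !comp_assoc muvk.
- move=> A X Y B p k v X' Y' u k' n Ep [orth_k _] [_ orth_k'] Nn nku.
  (* The diagonals come in two stages: [s] from [p] against [n ∘ k'], then [t] from [k] against
     [n]. *)
  have pn := NEpi_monic_orthogonal Ep (NMono_monic Nn).
  have [|s [[sp nks] _]] :=
    orthogonal_comp_r (orth_k' _ _ _ Ep) pn (u := u) (v := v ∘ k).
    exact: nku.
  have [|t [[tk nt] _]] := orth_k _ _ _ Nn (k' ∘ s) v.
    by rewrite comp_assoc.
  exists (s, t); split=> // [[s' t']] /= [s'p [_ nt']].
  f_equal; first by apply: (NEpi_epic Ep); rewrite sp s'p.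
  by apply: (NMono_monic Nn); rewrite nt nt'.
Qed.
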